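(* For any $(X,Y)\in\{(\Delta,\Gamma),(\Gamma,\Gamma),(\Delta,\Delta)\}$ the following holds. Let $S$ be the weight function of the colored stochastic $X$ vertex with spectral parameter $z_i$, $T$ that of the colored stochastic $Y$ vertex with spectral parameter $z_j$, and $R=R_{XY}$ that of the colored stochastic $X$-$Y$ vertex with spectral parameters $z_i,z_j$, with color set $\mathcal{C}=\{c_0,c_1,\dots,c_n\}$. Then for every choice of colors $a,b,c,d,e,f\in\mathcal{C}$, $$\sum_{g,h,k\in\mathcal{C}} R(a,b,g,k)\,S(g,c,d,h)\,T(k,h,e,f)=\sum_{j,m,l\in\mathcal{C}} T(b,c,j,m)\,S(a,m,l,f)\,R(l,j,d,e).$$
   Context: Parameters: $n\ge1$ is an integer; $q,z_i,z_j$ are indeterminates (equivalently, generic complex numbers for which every denominator is nonzero); $z_i'=q+1-\frac1{z_i}$, $z_j'=q+1-\frac1{z_j}$. Color labels are ordered by $0<1<\dots<n$. Any configuration not listed has weight $0$. Ordinary vertices: the weight is a function of the colors (left, top, right, bottom). For every color $x$, $(x,x,x,x)\mapsto 1$, and for all labels $\alpha<\beta$: - colored stochastic $\Gamma$ vertex with parameter $z$: $(c_\alpha,c_\beta,c_\alpha,c_\beta)\mapsto z$, $(c_\beta,c_\alpha,c_\beta,c_\alpha)\mapsto qz$, $(c_\beta,c_\alpha,c_\alpha,c_\beta)\mapsto 1-qz$, $(c_\alpha,c_\beta,c_\beta,c_\alpha)\mapsto 1-z$. - colored stochastic $\Delta$ vertex with parameter $z$ (with $z'=q+1-1/z$): $(c_\alpha,c_\beta,c_\alpha,c_\beta)\mapsto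 z'$, $(c_\beta,c_\alpha,c_\beta,c_\alpha)\mapsto\frac1q z'$, $(c_\beta,c_\beta,c_\alpha,c_\alpha)\mapsto 1-z'$, $(c_\alpha,c_\alpha,c_\beta,c_\beta)\mapsto 1-\frac1q z'$. R-vertices with spectral parameters $z_i,z_j$: the weight is a function of the colors (bottom-left, top-left, top-right, bottom-right). For every color $x$, $(x,x,x,x)\mapsto 1$, and for all labels $\alpha<\beta$: - $\Gamma$-$\Gamma$, with $P=1-(q+1)z_j+qz_iz_j$: $(c_\alpha,c_\beta,c_\alpha,c_\beta)\mapsto\frac{z_i-z_j}{P}$, $(c_\beta,c_\alpha,c_\beta,c_\alpha)\mapsto\frac{q(z_i-z_j)}{P}$, $(c_\beta,c_\alpha,c_\alpha,c_\beta)\mapsto\frac{(1-qz_i)(1-z_j)}{P}$, $(c_\alpha,c_\beta,c_\beta,c_\alpha)\mapsto\frac{(1-z_i)(1-qz_j)}{P}$. - $\Delta$-$\Gamma$: $(c_\alpha,c_\beta,c_\alpha,c_\beta)\mapsto\frac{z_i'+qz_j-(q+1)z_i'z_j}{1-z_i'z_j}$, $(c_\beta,c_\alpha,c_\beta,c_\alpha)\mapsto\frac{q^{-1}z_i'+z_j-(1+q^{-1})z_i'z_j}{1-z_i'z_j}$, $(c_\beta,c_\beta,c_\alpha,c_\alpha)\mapsto\frac{(1-z_i')(1-qz_j)}{1-z_i'z_j}$, $(c_\alpha,c_\alpha,c_\beta,c_\beta)\mapsto\frac{(1-q^{-1}z_i')(1-z_j)}{1-z_i'z_j}$. - $\Delta$-$\Delta$,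 with $Q=q-(q+1)z_i'+z_i'z_j'$: $(c_\alpha,c_\beta,c_\alpha,c_\beta)\mapsto\frac{z_j'-z_i'}{Q}$, $(c_\beta,c_\alpha,c_\beta,c_\alpha)\mapsto\frac{q(z_j'-z_i')}{Q}$, $(c_\beta,c_\alpha,c_\alpha,c_\beta)\mapsto\frac{(1-z_i')(q-z_j')}{Q}$, $(c_\alpha,c_\beta,c_\beta,c_\alpha)\mapsto\frac{(1-z_j')(q-z_i')}{Q}$. *)

(* Defs.v *)
From mathcomp Require Import all_boot all_order all_algebra.

Set Implicit Arguments.
Unset Strict Implicit.
Unset Printing Implicit Defensive.

Import GRing.Theory.
Local Open Scope ring_scope.

(* The color c_i is represented by its label i : 'I_n.+1. *)

(* Shape of a quadruple of colors: A stands for the smaller color alpha and B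
   for the larger color beta, read in the order of the arguments.  That order
   is (left, top, right, bottom) for ordinary vertices and
   (bottom-left, top-left, top-right, bottom-right) for R-vertices. *)
Variant config := Mono | ABAB | BABA | BAAB | ABBA | BBAA | AABB | Other.

Definition config_of (n : nat) (x1 x2 x3 x4 : 'I_n.+1) : config :=
  if [&& x1 == x2, x2 == x3 & x3 == x4] then Mono
  else if [&& x1 == x3, x2 == x4 & (x1 < x2)%N] then ABAB
  else if [&& x1 == x3, x2 == x4 & (x2 < x1)%N] then BABA
  else if [&& x1 == x4, x2 == x3 & (x2 < x1)%N] then BAAB
  else if [&& x1 == x4, x2 == x3 & (x1 < x2)%N] then ABBA
  else if [&& x1 == x2, x3 == x4 & (x3 < x1)%N] then BBAA
  else if [&& x1 == x2, x3 == x4 & (x1 < x3)%N] then AABB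
  else Other.

Definition prime_param (F : fieldType) (q z : F) : F := q + 1 - 1 / z.

Variant vertex_type := Gamma | Delta.

Definition vertex_weight (F : fieldType) (n : nat) (X : vertex_type) (q z : F)
    (left top right bottom : 'I_n.+1) : F :=
  let z' := prime_param q z in
  match X, config_of left top right bottom with
  | _, Mono => 1
  | Gamma, ABAB => z
  | Gamma, BABA => q * z
  | Gamma, BAAB => 1 - q * z
  | Gamma, ABBA => 1 - z
  | Delta, ABAB => z'
  | Delta, BABA => 1 / q * z'
  | Delta, BBAA => 1 - z'
  | Delta, AABB => 1 - 1 / q * z'
  | _, _ => 0
  end.

(* The admissible pairs (X, Y); there is no Gamma-Delta R-vertex here. *)
Variant R_type := DeltaGamma | GammaGamma | DeltaDelta.

Definition fst_type (XY : R_type) : vertex_type :=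
  match XY with GammaGamma => Gamma | DeltaGamma | DeltaDelta => Delta end.

Definition snd_type (XY : R_type) : vertex_type :=
  match XY with DeltaGamma | GammaGamma => Gamma | DeltaDelta => Delta end.

Definition R_denom (F : fieldType) (XY : R_type) (q zi zj : F) : F :=
  let zi' := prime_param q zi in
  let zj' := prime_param q zj in
  match XY with
  | GammaGamma => 1 - (q + 1) * zj + q * zi * zj
  | DeltaGamma => 1 - zi' * zj
  | DeltaDelta => q - (q + 1) * zi' + zi' * zj'
  end.

Definition R_weight (F : fieldType) (n : nat) (XY : R_type) (q zi zj : F)
    (botleft topleft topright botright : 'I_n.+1) : F :=
  let zi' := prime_param q zi in
  let zj' := prime_param q zj in
  let D := R_denom XY q zi zj in
  match XY, config_of botleft topleft topright botright with
  | _, Mono => 1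
  | GammaGamma, ABAB => (zi - zj) / D
  | GammaGamma, BABA => q * (zi - zj) / D
  | GammaGamma, BAAB => (1 - q * zi) * (1 - zj) / D
  | GammaGamma, ABBA => (1 - zi) * (1 - q * zj) / D
  | DeltaGamma, ABAB => (zi' + q * zj - (q + 1) * zi' * zj) / D
  | DeltaGamma, BABA => (q^-1 * zi' + zj - (1 + q^-1) * zi' * zj) / D
  | DeltaGamma, BBAA => (1 - zi') * (1 - q * zj) / D
  | DeltaGamma, AABB => (1 - q^-1 * zi') * (1 - zj) / D
  | DeltaDelta, ABAB => (zj' - zi') / D
  | DeltaDelta, BABA => q * (zj' - zi') / D
  | DeltaDelta, BAAB => (1 - zi') * (q - zj') / D
  | DeltaDelta, ABBA => (1 - zj') * (q - zi') / D
  | _, _ => 0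
  end.

(* Genericity: every denominator occurring in the weights of the X, Y and X-Y
   vertices is nonzero (MathComp inverts 0 to 0, so this must be assumed). *)
Definition generic_params (F : fieldType) (XY : R_type) (q zi zj : F) : Prop :=
  match XY with
  | GammaGamma => R_denom XY q zi zj != 0
  | DeltaGamma => [/\ q != 0, zi != 0 & R_denom XY q zi zj != 0]
  | DeltaDelta => [/\ q != 0, zi != 0, zj != 0 & R_denom XY q zi zj != 0]
  end.

(* Main.v *)
Require Import Defs.
From mathcomp Require Import all_boot all_order all_algebra.
From mathcomp Require Import zify ring.
Import GRing.Theory.
Local Open Scope ring_scope.

(** In every vertex the four colors are paired off: colors pass straight
    through, and otherwise they are exchanged ([cross], the Gamma pattern) or
    turn around ([cup], the Delta pattern).  Written with Kronecker deltas, the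
    weights make the three inner sums collapse on both sides of the equation.
    What remains is supported on boundary colors that match up in three pairs,
    so at most three colors occur, and for each of their relative orders one is
    left with an identity of rational functions.  The Delta identities hold
    with [z'] a free variable. *)

(** * Weights as Kronecker deltas, and their partial sums *)

Section KroneckerExpansion.
Variables (F : fieldType) (n : nat).
Implicit Types (x y z t : 'I_n.+1) (u v w : 'I_n.+1 -> 'I_n.+1 -> F).

Definition by_order (e l g : F) x y : F :=
  if x == y then e else if (x < y)%N then l else g.

Definition cross u v x1 x2 x3 x4 : F :=
  (x1 == x3)%:R * (x2 == x4)%:R * u x1 x2
  + (x1 == x4)%:R * (x2 == x3)%:R * v x1 x2.

Definition cup u w x1 x2 x3 x4 : F :=
  (x1 == x3)%:R * (x2 == x4)%:R * u x1 x2
  + (x1 == x2)%:R * (x3 == x4)%:R * w x1 x3.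

(** Both delta products equal 1 exactly when all four colors agree; the diagonal values 1 and 0 of
    the two coefficients then count the monochromatic weight once. [cupE] uses the same device. *)
Lemma crossE ab ba baab abba x1 x2 x3 x4 :
  match config_of x1 x2 x3 x4 with
  | Mono => 1 | ABAB => ab | BABA => ba | BAAB => baab | ABBA => abba | _ => 0
  end = cross (by_order 1 ab ba) (by_order 0 abba baab) x1 x2 x3 x4.
Proof.
rewrite /config_of /cross /by_order -!val_eqE /=.
case: (ltngtP x1 x2) => h12; case: (ltngtP x1 x3) => h13;
case: (ltngtP x2 x4) => h24; case: (ltngtP x1 x4) => h14;
case: (ltngtP x2 x3) => h23; case: (ltngtP x3 x4) => h34 //=;
  solve [ring | lia].
Qed.

Lemma cupE ab ba bbaa aabb x1 x2 x3 x4 :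
  match config_of x1 x2 x3 x4 with
  | Mono => 1 | ABAB => ab | BABA => ba | BBAA => bbaa | AABB => aabb | _ => 0
  end = cup (by_order 1 ab ba) (by_order 0 aabb bbaa) x1 x2 x3 x4.
Proof.
rewrite /config_of /cup /by_order -!val_eqE /=.
case: (ltngtP x1 x2) => h12; case: (ltngtP x1 x3) => h13;
case: (ltngtP x2 x4) => h24; case: (ltngtP x1 x4) => h14;
case: (ltngtP x2 x3) => h23; case: (ltngtP x3 x4) => h34 //=;
  solve [ring | lia].
Qed.

Lemma sum_delta x (G : 'I_n.+1 -> F) : \sum_y (x == y)%:R * G y = G x.
Proof.
rewrite (bigD1 x) //= eqxx mul1r big1 ?addr0 // => y /negPf.
by rewrite eq_sym => ->; rewrite mul0r.
Qed.

(** Here and below, the digits in a name are the positions summed over. *)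
Lemma cross_sum34 u v x1 x2 (G : 'I_n.+1 -> 'I_n.+1 -> F) :
  \sum_x3 \sum_x4 cross u v x1 x2 x3 x4 * G x3 x4
  = u x1 x2 * G x1 x2 + v x1 x2 * G x2 x1.
Proof.
rewrite -(sum_delta x1 (fun x => u x1 x2 * G x x2)).
rewrite -(sum_delta x2 (fun x => v x1 x2 * G x x1)).
rewrite -big_split; apply: eq_bigr => x3 _ /=.
rewrite -(sum_delta x2 (fun x => u x1 x2 * G x3 x)).
rewrite -(sum_delta x1 (fun x => v x1 x2 * G x3 x)).
by rewrite !mulr_sumr -big_split; apply: eq_bigr => x4 _ /=; rewrite /cross; ring.
Qed.

Lemma cross_sum4 u v x1 x2 x3 (G : 'I_n.+1 -> F) :
  \sum_x4 cross u v x1 x2 x3 x4 * G x4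
  = (x1 == x3)%:R * u x1 x2 * G x2 + (x2 == x3)%:R * v x1 x2 * G x1.
Proof.
rewrite -(sum_delta x2 (fun x => (x1 == x3)%:R * u x1 x2 * G x)).
rewrite -(sum_delta x1 (fun x => (x2 == x3)%:R * v x1 x2 * G x)).
by rewrite -big_split; apply: eq_bigr => x4 _ /=; rewrite /cross; ring.
Qed.

Lemma cross_sum3 u v x1 x2 x4 (G : 'I_n.+1 -> F) :
  \sum_x3 cross u v x1 x2 x3 x4 * G x3
  = (x2 == x4)%:R * u x1 x2 * G x1 + (x1 == x4)%:R * v x1 x2 * G x2.
Proof.
rewrite -(sum_delta x1 (fun x => (x2 == x4)%:R * u x1 x2 * G x)).
rewrite -(sum_delta x2 (fun x => (x1 == x4)%:R * v x1 x2 * G x)).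
by rewrite -big_split; apply: eq_bigr => x3 _ /=; rewrite /cross; ring.
Qed.

(** A turn at [x1 = x2] only forces the other two positions to agree with each other, so a sum over
    one free color survives. *)
Lemma cup_sum34 u w x1 x2 (G : 'I_n.+1 -> 'I_n.+1 -> F) :
  \sum_x3 \sum_x4 cup u w x1 x2 x3 x4 * G x3 x4
  = u x1 x2 * G x1 x2 + (x1 == x2)%:R * \sum_x w x1 x * G x x.
Proof.
rewrite -(sum_delta x1 (fun x => u x1 x2 * G x x2)) mulr_sumr -big_split.
apply: eq_bigr => x3 _ /=.
rewrite -(sum_delta x2 (fun x => u x1 x2 * G x3 x)).
rewrite -(sum_delta x3 (fun x => w x1 x3 * G x3 x)).
by rewrite !mulr_sumr -big_split; apply: eq_bigr => x4 _ /=; rewrite /cup; ring.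
Qed.

Lemma cup_sum4 u w x1 x2 x3 (G : 'I_n.+1 -> F) :
  \sum_x4 cup u w x1 x2 x3 x4 * G x4
  = (x1 == x3)%:R * u x1 x2 * G x2 + (x1 == x2)%:R * w x1 x3 * G x3.
Proof.
rewrite -(sum_delta x2 (fun x => (x1 == x3)%:R * u x1 x2 * G x)).
rewrite -(sum_delta x3 (fun x => (x1 == x2)%:R * w x1 x3 * G x)).
by rewrite -big_split; apply: eq_bigr => x4 _ /=; rewrite /cup; ring.
Qed.

(** [x2] stands on the left of both deltas, as [sum_two_deltas] expects when [x2] is the bound
    color. *)
Lemma cup_sum3 u w x1 x2 x4 (G : 'I_n.+1 -> F) :
  \sum_x3 cup u w x1 x2 x3 x4 * G x3
  = (x2 == x4)%:R * u x1 x2 * G x1 + (x2 == x1)%:R * w x1 x4 * G x4.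
Proof.
rewrite -(sum_delta x1 (fun x => (x2 == x4)%:R * u x1 x2 * G x)).
rewrite -(sum_delta x4 (fun x => (x2 == x1)%:R * w x1 x * G x)).
rewrite -big_split; apply: eq_bigr => x3 _ /=.
by rewrite /cup (eq_sym x4) (eq_sym x2 x1); ring.
Qed.

(** Evaluates the sum left over by [cup_sum34]: after the adjacent vertex is summed, the free color
    must be one of two boundary colors. *)
Lemma sum_two_deltas y z (H A B : 'I_n.+1 -> F) :
  \sum_t H t * ((t == y)%:R * A t + (t == z)%:R * B t) = H y * A y + H z * B z.
Proof.
rewrite -(sum_delta y (fun t => H t * A t)) -(sum_delta z (fun t => H t * B t)).
rewrite -big_split; apply: eq_bigr => t _ /=.
by rewrite (eq_sym y) (eq_sym z); ring.
Qed.

Lemma by_order_eq e l g x : by_order e l g x x = e.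
Proof. by rewrite /by_order eqxx. Qed.

Lemma by_order_lt e l g x y : (x < y)%N -> by_order e l g x y = l.
Proof. by move=> ltxy; rewrite /by_order ltxy -val_eqE ltn_eqF. Qed.

Lemma by_order_gt e l g x y : (x < y)%N -> by_order e l g y x = g.
Proof. by move=> ltxy; rewrite /by_order -val_eqE gtn_eqF // ltnNge ltnW. Qed.

Lemma neq_ord_lt x y : x != y -> (x < y)%N \/ (y < x)%N.
Proof. by rewrite -val_eqE neq_ltn => /orP. Qed.

End KroneckerExpansion.

Arguments by_order {F n}.
Arguments cross {F n}.
Arguments cup {F n}.

(** * Case analysis on equalities and order of the boundary colors *)

Ltac split_deltas :=
  repeat (match goal with |- context [?x == ?y] =>
    case: (eqVneq x y) => [?|?];
    [subst; try match goal with
       ne : is_true (?z != ?z) |- _ => by rewrite eqxx in ne end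
    |] end;
    rewrite ?eqxx /= ?(mul0r, mulr0, mul1r, mulr1, addr0, add0r);
    try reflexivity).

(** Ordering three distinct colors pair by pair gives eight cases, of which the two cyclic ones are
    contradictory. *)
Ltac absurd_order := match goal with
  | xy : is_true (nat_of_ord ?x < nat_of_ord ?y)%N,
    yz : is_true (nat_of_ord ?y < nat_of_ord ?z)%N,
    zx : is_true (nat_of_ord ?z < nat_of_ord ?x)%N |- _ =>
      by have := ltn_trans (ltn_trans xy yz) zx; rewrite ltnn
  end.

Ltac split_orders := repeat match goal with
  | |- context [by_order _ _ _ ?x ?x] => rewrite !(by_order_eq _ _ _ _ _ x)
  | lt : is_true (nat_of_ord ?x < nat_of_ord ?y)%N
    |- context [by_order _ _ _ ?x ?y] => rewrite !(by_order_lt _ _ _ _ _ _ _ lt)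
  | lt : is_true (nat_of_ord ?x < nat_of_ord ?y)%N
    |- context [by_order _ _ _ ?y ?x] => rewrite !(by_order_gt _ _ _ _ _ _ _ lt)
  | ne : is_true (?x != ?y) |- context [by_order _ _ _ ?x ?y] =>
    case: (neq_ord_lt _ _ _ ne) => ?; try absurd_order
  | ne : is_true (?x != ?y) |- context [by_order _ _ _ ?y ?x] =>
    case: (neq_ord_lt _ _ _ ne) => ?; try absurd_order
  end.

(** * The three Yang-Baxter equations *)

Section YangBaxter.
Variables (F : fieldType) (n : nat).
Local Notation weight := ('I_n.+1 -> 'I_n.+1 -> 'I_n.+1 -> 'I_n.+1 -> F).

(** Nested so that the outer double sum contracts the first vertex and the inner sum contracts [S],
    matching the partial-sum lemmas. *)
Definition yang_baxter (R S T : weight) := forall a b c d e f,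
  \sum_g \sum_k R a b g k * \sum_h S g c d h * T k h e f
  = \sum_j \sum_m T b c j m * \sum_l S a m l f * R l j d e.

(** Bridge to the triple sums of the theorem; [R'], [S'], [T'] are meant to be the Kronecker forms
    of [R], [S], [T]. *)
Lemma yang_baxter_sum3 (R S T R' S' T' : weight) :
    (forall x1 x2 x3 x4, R x1 x2 x3 x4 = R' x1 x2 x3 x4) ->
    (forall x1 x2 x3 x4, S x1 x2 x3 x4 = S' x1 x2 x3 x4) ->
    (forall x1 x2 x3 x4, T x1 x2 x3 x4 = T' x1 x2 x3 x4) ->
    yang_baxter R' S' T' ->
  forall a b c d e f,
    \sum_g \sum_h \sum_k R a b g k * S g c d h * T k h e f
    = \sum_j \sum_m \sum_l T b c j m * S a m l f * R l j d e.
Proof.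
move=> eR eS eT YB a b c d e f.
transitivity (\sum_g \sum_k R' a b g k * \sum_h S' g c d h * T' k h e f).
  apply: eq_bigr => g _; rewrite exchange_big; apply: eq_bigr => k _ /=.
  by rewrite mulr_sumr; apply: eq_bigr => h _; rewrite mulrA eR eS eT.
rewrite YB; apply: eq_bigr => j _; apply: eq_bigr => m _.
by rewrite mulr_sumr; apply: eq_bigr => l _; rewrite mulrA eR eS eT.
Qed.

Lemma yang_baxter_GammaGamma (q x y : F) :
  let D := 1 - (q + 1) * y + q * x * y in
  D != 0 ->
  yang_baxter
    (cross (by_order 1 ((x - y) / D) (q * (x - y) / D))
       (by_order 0 ((1 - x) * (1 - q * y) / D) ((1 - q * x) * (1 - y) / D)))
    (cross (by_order 1 x (q * x)) (by_order 0 (1 - x) (1 - q * x)))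
    (cross (by_order 1 y (q * y)) (by_order 0 (1 - y) (1 - q * y))).
Proof.
(* The identities depend on the expression of [D], so [field] must see it unfolded. *)
move=> D D0 a b c d e f; move: D0; rewrite /D => D0.
rewrite !cross_sum34 !cross_sum4 !cross_sum3 /cross.
by split_deltas; split_orders; field; rewrite ?D0.
Qed.

Lemma yang_baxter_DeltaGamma (q x y : F) :
  let D := 1 - x * y in
  q != 0 -> D != 0 ->
  yang_baxter
    (cup (by_order 1 ((x + q * y - (q + 1) * x * y) / D)
            ((q^-1 * x + y - (1 + q^-1) * x * y) / D))
       (by_order 0 ((1 - q^-1 * x) * (1 - y) / D) ((1 - x) * (1 - q * y) / D)))
    (cup (by_order 1 x (1 / q * x)) (by_order 0 (1 - 1 / q * x) (1 - x)))
    (cross (by_order 1 y (q * y)) (by_order 0 (1 - y) (1 - q * y))).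
Proof.
move=> D q0 D0 a b c d e f; move: D0; rewrite /D => D0.
rewrite !cup_sum34 !cross_sum34 !cup_sum4 !cup_sum3.
(* The free color comes from the turn in [R] on the left side; summing [S] forces it to be [d] or
   [c]. *)
under eq_bigr do rewrite cup_sum4 -!mulrA.
rewrite sum_two_deltas /cup /cross.
by split_deltas; split_orders; field; rewrite ?q0 ?D0.
Qed.

Lemma yang_baxter_DeltaDelta (q x y : F) :
  let D := q - (q + 1) * x + x * y in
  q != 0 -> D != 0 ->
  yang_baxter
    (cross (by_order 1 ((y - x) / D) (q * (y - x) / D))
       (by_order 0 ((1 - y) * (q - x) / D) ((1 - x) * (q - y) / D)))
    (cup (by_order 1 x (1 / q * x)) (by_order 0 (1 - 1 / q * x) (1 - x)))
    (cup (by_order 1 y (1 / q * y)) (by_order 0 (1 - 1 / q * y) (1 - y))).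
Proof.
move=> D q0 D0 a b c d e f; move: D0; rewrite /D => D0.
rewrite !cross_sum34 !cup_sum34 !cup_sum4 !cup_sum3.
(* Here it comes from the turn in [T] on the right side, and [S] forces it to be [f] or [a]. *)
under eq_bigr do rewrite cup_sum3 -!mulrA.
rewrite sum_two_deltas /cup /cross.
by split_deltas; split_orders; field; rewrite ?q0 ?D0.
Qed.

End YangBaxter.

Theorem theorem4p1 (F : fieldType) (n : nat) (hn : (1 <= n)%N)
    (q zi zj : F) (XY : R_type) (hgen : generic_params XY q zi zj) :
  let S := @vertex_weight F n (fst_type XY) q zi in
  let T := @vertex_weight F n (snd_type XY) q zj in
  let R := @R_weight F n XY q zi zj in
  forall a b c d e f : 'I_n.+1,
    \sum_(g : 'I_n.+1) \sum_(h : 'I_n.+1) \sum_(k : 'I_n.+1)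
      R a b g k * S g c d h * T k h e f
    = \sum_(j : 'I_n.+1) \sum_(m : 'I_n.+1) \sum_(l : 'I_n.+1)
      T b c j m * S a m l f * R l j d e.
Proof.
move=> S T R; rewrite {}/S {}/T {}/R; case: XY hgen => [[q0 _ D0]|D0|[q0 _ _ D0]].
(* The Delta-Gamma R-vertex is a cup; R-vertices of two equal types are crosses. Unifying [D0] with
   the denominator of the lemma instantiates [x] and [y], here by z_i' and z_j. *)
- by apply: (yang_baxter_sum3 _ _ _ _ _ _ _ _ _ _ _
      (yang_baxter_DeltaGamma _ _ _ _ _ q0 D0)) => *;
    [exact: cupE | exact: cupE | exact: crossE].
- by apply: (yang_baxter_sum3 _ _ _ _ _ _ _ _ _ _ _
      (yang_baxter_GammaGamma _ _ _ _ _ D0)) => *;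
    exact: crossE.
- by apply: (yang_baxter_sum3 _ _ _ _ _ _ _ _ _ _ _
      (yang_baxter_DeltaDelta _ _ _ _ _ q0 D0)) => *;
    [exact: crossE | exact: cupE | exact: cupE].
Qed.
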